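(* Let $n\ge2$ be even and let $y,z\in\tilde I^{\mathsf{FPF}}_n$ with $y\lessdot_F z$. Then the map $(\pi,t)\mapsto\pi t$ is a bijection from the set of pairs $(\pi,t)\in\mathcal A^{\mathsf{FPF}}(y)\times R(\tilde S_n)$ with $\pi\lessdot\pi t$ and $z=tyt$ onto $\mathcal A^{\mathsf{FPF}}(z)$.
   Context: $\tilde S_n$ is the group of bijections $\pi:\mathbb Z\to\mathbb Z$ with $\pi(i+n)=\pi(i)+n$ and $\sum_{i=1}^n\pi(i)=\sum_{i=1}^n i$, a Coxeter group with generators $s_1,\dots,s_n$ ($s_i$ swaps $i+kn,i+1+kn$ for all $k$) and length $\ell$. $R(\tilde S_n)$ is the set of reflections, namely the elements $t_{ij}$ ($i<j$, $j\not\equiv i\pmod n$) exchanging $i+kn,j+kn$ for all $k$ and fixing other integers. $\pi\lessdot\sigma$ denotes a cover in the Bruhat order of $\tilde S_n$: $\sigma=\pi t$ for some reflection $t$ and $\ell(\sigma)=\ell(\pi)+1$. $\tilde I^{\mathsf{FPF}}_n$ is the set of $z\in\tilde S_n$ with $z(z(i))=i\neq z(i)$ for all $i$. With $\Theta^+=s_1s_3\cdots s_{n-1}$, $\Theta^-=s_2s_4\cdots s_n$, each $z$ is conjugate to exactly one $\Theta\in\{\Theta^\pm\}$; $\mathcal A^{\mathsf{FPF}}(z)$ is the set of minimal-length $w$ with $w^{-1}\Theta w=z$. $\hat\ell_{\mathsf{FPF}}(z)=\frac12(\ell(z)-\frac n2)$, and $y\lessdot_F z$ means $z=tyt$ for some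 reflection $t$ and $\hat\ell_{\mathsf{FPF}}(z)=\hat\ell_{\mathsf{FPF}}(y)+1$. *)

(* Defs.v *)
From HB Require Import structures.
From mathcomp Require Import all_boot all_order all_algebra.
From mathcomp Require Import boolp classical_sets functions.
From mathcomp Require Import ring.

Set Implicit Arguments.
Unset Strict Implicit.
Unset Printing Implicit Defensive.

Import Order.TTheory GRing.Theory Num.Theory.
Local Open Scope classical_set_scope.
Local Open Scope ring_scope.

Definition is_affine_perm (n : nat) (f : int -> int) : Prop :=
  [/\ bijective f,
      forall i, f (i + n%:Z) = f i + n%:Z
    & \sum_(1 <= i < n.+1) f i%:Z = \sum_(1 <= i < n.+1) i%:Z].

Record affine_perm (n : nat) := AffinePerm {
  aperm_val :> int -> int;
  aperm_axiom : is_affine_perm n aperm_val }.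

HB.instance Definition _ n := gen_eqMixin (affine_perm n).
HB.instance Definition _ n := gen_choiceMixin (affine_perm n).

Lemma aperm_ext n (p q : affine_perm n) : p =1 q -> p = q.
Proof.
case: p q => [f fP] [g gP] /= /funext fg.
by move: gP; rewrite -fg => gP; congr AffinePerm; exact: Prop_irrelevance.
Qed.

Section AffinePermTheory.
Variable n : nat.
Implicit Types f g : int -> int.

Lemma intSr (m : nat) : m.+1%:Z = m%:Z + 1.
Proof. by rewrite -addn1 PoszD. Qed.

Lemma periodicM f : (forall i, f (i + n%:Z) = f i + n%:Z) ->
  forall i (k : int), f (i + k * n%:Z) = f i + k * n%:Z.
Proof.
move=> fn.
have pos i (k : nat) : f (i + k%:Z * n%:Z) = f i + k%:Z * n%:Z.
  elim: k i => [|k IH] i; first by rewrite !mul0r !addr0.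
  by rewrite intSr mulrDl mul1r !addrA fn IH.
move=> i [k|k]; first exact: pos.
have /= := pos (i + Negz k * n%:Z) k.+1.
rewrite NegzE mulNr addrNK => ->.
by rewrite addrK.
Qed.

Lemma periodic_mod f : (forall i, f (i + n%:Z) = f i) ->
  forall i, f (i %% n%:Z)%Z = f i.
Proof.
move=> fn i.
have pos j (k : nat) : f (j + k%:Z * n%:Z) = f j.
  elim: k j => [|k IH] j; first by rewrite mul0r addr0.
  by rewrite intSr mulrDl mul1r addrA fn IH.
rewrite {2}(divz_eq i n%:Z) addrC.
case: (divz i n%:Z) => k; first by rewrite pos.
by rewrite -[in LHS](addrNK (k.+1%:Z * n%:Z) (i %% n%:Z)%Z) pos NegzE mulNr.
Qed.

Lemma sum_periodic_reindex f g : bijective f ->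
  (forall i, f (i + n%:Z) = f i + n%:Z) -> (forall i, g (i + n%:Z) = g i) ->
  \sum_(1 <= i < n.+1) g (f i%:Z) = \sum_(1 <= i < n.+1) g i%:Z.
Proof.
move=> /bij_inj f_inj fn gn.
case: (posnP n) => [n0|n_gt0]; first by rewrite [in n.+1]n0 !big_geq ?n0.
have nz_neq0 : n%:Z != 0 by rewrite eqz_nat -lt0n.
rewrite !big_add1 /= !big_mkord.
have hP (i : 'I_n) : (`|((f i.+1%:Z - 1) %% n%:Z)%Z| < n)%N.
  by rewrite -ltz_nat gez0_abs ?modz_ge0// ltz_pmod// ltz_nat.
pose h i := Ordinal (hP i).
have hE i : (h i)%:Z = ((f i.+1%:Z - 1) %% n%:Z)%Z.
  by rewrite /= gez0_abs ?modz_ge0.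
have h_inj : injective h.
  move=> i j /(congr1 (fun x : 'I_n => x%:Z)); rewrite !hE => eqm.
  pose k := ((f i.+1%:Z - 1) %/ n%:Z)%Z - ((f j.+1%:Z - 1) %/ n%:Z)%Z.
  have : f i.+1%:Z = f j.+1%:Z + k * n%:Z.
    have := divz_eq (f i.+1%:Z - 1) n%:Z; have := divz_eq (f j.+1%:Z - 1) n%:Z.
    rewrite eqm /k; move: (divz _ _) (divz _ _) (modz _ _) => a b r Ej Ei.
    rewrite -[LHS](subrK 1) -[f j.+1%:Z in RHS](subrK 1) Ei Ej; ring.
  rewrite -(periodicM fn) => /f_inj; move: k => k eij.
  have: (i%:Z = j%:Z %[mod n%:Z])%Z.
    have -> : i%:Z = k * n%:Z + j%:Z.
      apply: (addIr 1); move: eij; rewrite !intSr => ->; by rewrite addrC addrA.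
    by rewrite modzMDl.
  by rewrite !modz_nat !modn_small// => /eqP; rewrite eqz_nat => /eqP /val_inj.
rewrite [RHS](reindex_inj h_inj) /=; apply: eq_bigr => i _.
have gn' j : g (j + n%:Z + 1) = g (j + 1) by rewrite addrAC gn.
have := periodic_mod gn' (f i.+1%:Z - 1); rewrite subrK => <-.
by rewrite -hE intSr.
Qed.

Lemma disp_periodic f : (forall i, f (i + n%:Z) = f i + n%:Z) ->
  forall i, f (i + n%:Z) - (i + n%:Z) = f i - i.
Proof. by move=> fn i; rewrite fn opprD addrACA subrr addr0. Qed.

Lemma sum_dispP f : \sum_(1 <= i < n.+1) f i%:Z = \sum_(1 <= i < n.+1) i%:Z <->
  \sum_(1 <= i < n.+1) (f i%:Z - i%:Z) = 0.
Proof.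
rewrite sumrB; split=> [->|/eqP]; first by rewrite subrr.
by rewrite subr_eq0 => /eqP.
Qed.

Lemma aperm_id_subproof : is_affine_perm n id.
Proof. by split=> //; exists id. Qed.

Lemma aperm_comp_subproof f g :
  is_affine_perm n f -> is_affine_perm n g -> is_affine_perm n (f \o g).
Proof.
move=> [fb fn /sum_dispP fs] [gb gn /sum_dispP gs].
split; [exact: bij_comp | by move=> i /=; rewrite gn fn |].
apply/sum_dispP.
under eq_bigr => i _ do rewrite /= -(subrKA (g i%:Z)).
rewrite big_split /= gs addr0.
by rewrite (sum_periodic_reindex gb gn (disp_periodic fn)).
Qed.

Lemma bij_inv_exists f : bijective f -> exists g, cancel f g /\ cancel g f.
Proof. by case=> g fK gK; exists g. Qed.

Definition aperm_inv_fun (p : affine_perm n) : int -> int :=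
  let: And3 pb _ _ := aperm_axiom p in projT1 (cid (bij_inv_exists pb)).

Lemma aperm_inv_funK (p : affine_perm n) :
  cancel p (aperm_inv_fun p) /\ cancel (aperm_inv_fun p) p.
Proof.
rewrite /aperm_inv_fun; case: (aperm_axiom p) => pb ? ?.
by case: (cid _).
Qed.

Lemma aperm_inv_subproof (p : affine_perm n) : is_affine_perm n (aperm_inv_fun p).
Proof.
have [pK Kp] := aperm_inv_funK p; set q := aperm_inv_fun p in pK Kp *.
have [pb pn /sum_dispP ps] := aperm_axiom p.
have qn i : q (i + n%:Z) = q i + n%:Z.
  by apply: (can_inj pK); rewrite pn !Kp.
split=> //; first by exists p.
apply/sum_dispP; rewrite -(sum_periodic_reindex pb pn (disp_periodic qn)).
under eq_bigr do rewrite pK -opprB.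
by rewrite sumrN ps oppr0.
Qed.

Definition aperm_one := AffinePerm aperm_id_subproof.
Definition aperm_mul (p q : affine_perm n) :=
  AffinePerm (aperm_comp_subproof (aperm_axiom p) (aperm_axiom q)).
Definition aperm_inv (p : affine_perm n) := AffinePerm (aperm_inv_subproof p).

Lemma aperm_mulA : associative aperm_mul.
Proof. by move=> p q r; apply: aperm_ext. Qed.
Lemma aperm_mul1 : left_id aperm_one aperm_mul.
Proof. by move=> p; apply: aperm_ext. Qed.
Lemma aperm_mulr1 : right_id aperm_one aperm_mul.
Proof. by move=> p; apply: aperm_ext. Qed.
Lemma aperm_mulV : left_inverse aperm_one aperm_inv aperm_mul.
Proof. by move=> p; apply: aperm_ext => i /=; case: (aperm_inv_funK p). Qed.
Lemma aperm_mulrV : right_inverse aperm_one aperm_inv aperm_mul.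
Proof. by move=> p; apply: aperm_ext => i /=; case: (aperm_inv_funK p). Qed.

(* When i = j modulo n there is no such transposition; the identity is a
   junk value. *)
Definition transp_fun (i j x : int) : int :=
  if (i == j %[mod n%:Z])%Z then x
  else if (x == i %[mod n%:Z])%Z then x + (j - i)
  else if (x == j %[mod n%:Z])%Z then x - (j - i)
  else x.

Lemma transp_subproof i j : is_affine_perm n (transp_fun i j).
Proof.
rewrite /transp_fun; case: (boolP (i == j %[mod n%:Z])%Z) => ij.
  exact: aperm_id_subproof.
have modD a (b : int) : (a + n%:Z == b %[mod n%:Z])%Z = (a == b %[mod n%:Z])%Z.
  by rewrite modzDr.
have subm (a b : int) : (a == b %[mod n%:Z])%Z = (n%:Z %| a - b)%Z.
  by rewrite eqz_mod_dvd.
split.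
- set t := (t in bijective t); suff tK : cancel t t by exists t.
  move=> x; rewrite [X in t X]/t.
  case: (boolP (x == i %[mod n%:Z])%Z) => xi;
    last case: (boolP (x == j %[mod n%:Z])%Z) => xj; rewrite /t.
  + have e : (x + (j - i) == j %[mod n%:Z])%Z.
      by rewrite subm (_ : x + (j - i) - j = x - i); [rewrite -subm | ring].
    have -> : (x + (j - i) == i %[mod n%:Z])%Z = false.
      by apply: contraNF ij; rewrite -(eqP e) eq_sym.
    by rewrite e addrK.
  + have -> : (x - (j - i) == i %[mod n%:Z])%Z.
      by rewrite subm (_ : x - (j - i) - i = x - j); [rewrite -subm | ring].
    by rewrite subrK.
  + by rewrite (negbTE xi) (negbTE xj).
- move=> x; rewrite !modD; case: ifP => _; first by rewrite addrAC.
  by case: ifP => _ //; rewrite addrAC.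
- apply/(sum_dispP (fun x => if (x == i %[mod n%:Z])%Z then x + (j - i)
    else if (x == j %[mod n%:Z])%Z then x - (j - i) else x)).
  pose g (x : int) := if (x == i %[mod n%:Z])%Z then j - i else 0.
  pose s (x : int) := x + (i - j).
  have -> : \sum_(1 <= x < n.+1)
      ((if (x%:Z == i %[mod n%:Z])%Z then x%:Z + (j - i)
        else if (x%:Z == j %[mod n%:Z])%Z then x%:Z - (j - i) else x%:Z) - x%:Z)
    = \sum_(1 <= x < n.+1) (g x%:Z - g (s x%:Z)).
    apply: eq_bigr => x _; rewrite /g /s.
    have -> : (x%:Z + (i - j) == i %[mod n%:Z])%Z = (x%:Z == j %[mod n%:Z])%Z.
      by rewrite !subm (_ : x%:Z + (i - j) - i = x%:Z - j)//; ring.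
    case: ifPn => xi.
      have -> : (x%:Z == j %[mod n%:Z])%Z = false.
        by apply: contraNF ij; rewrite (eqP xi).
      by rewrite subr0 addrC addKr.
    case: ifPn => _; last by rewrite !subrr.
    by rewrite sub0r addrC addKr.
  rewrite sumrB (sum_periodic_reindex (f := s)) ?subrr//.
  + by exists (fun x => x - (i - j)) => x; rewrite /s ?addrK ?subrK.
  + by move=> x; rewrite /s addrAC.
  + by move=> x; rewrite /g modD.
Qed.

Definition transp (i j : int) : affine_perm n := AffinePerm (transp_subproof i j).

End AffinePermTheory.

HB.instance Definition _ n := isGroup.Build (affine_perm n)
  (@aperm_mulA n) (@aperm_mul1 n) (@aperm_mulr1 n)
  (@aperm_mulV n) (@aperm_mulrV n).

Lemma aperm1E n (x : int) : (1%g : affine_perm n) x = x.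
Proof. by []. Qed.
Lemma apermME n (p q : affine_perm n) (x : int) : (p * q)%g x = p (q x).
Proof. by []. Qed.

Section FPF.
Variable n : nat.
Implicit Types p q t w y z : affine_perm n.

Definition simple_transp (i : nat) : affine_perm n := transp n i%:Z (i%:Z + 1).

Definition word_lengths w : set nat :=
  [set k | exists u : seq nat,
     [/\ size u = k, all (fun i => (1 <= i <= n)%N) u
       & w = (\prod_(i <- u) simple_transp i)%g]].

(* For 2 <= n the simple transpositions generate affine_perm n, so the
   default value 0 of xget is not used. *)
Definition coxeter_length w : nat :=
  xget 0%N [set k | word_lengths w k /\
                    forall m, word_lengths w m -> (k <= m)%N].

Definition reflections : set (affine_perm n) :=
  [set t | exists i j : int,
     [/\ i < j, ~~ (j == i %[mod n%:Z])%Z & t = transp n i j]].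

Definition bruhat_cover p q : Prop :=
  exists2 t, reflections t &
    q = (p * t)%g /\ coxeter_length q = (coxeter_length p + 1)%N.

Definition fpf_involutions : set (affine_perm n) :=
  [set z : affine_perm n | forall i : int, z (z i) = i /\ z i <> i].

Definition Theta_plus : affine_perm n :=
  (\prod_(1 <= i < n.+1 | odd i) simple_transp i)%g.

Definition Theta_minus : affine_perm n :=
  (\prod_(1 <= i < n.+1 | ~~ odd i) simple_transp i)%g.

(* For n even, a fixed-point-free involution z is conjugate to exactly one of
   Theta_plus and Theta_minus, so at most one disjunct contributes. *)
Definition fpf_atoms z : set (affine_perm n) :=
  [set w | exists Theta : affine_perm n,
     [/\ Theta = Theta_plus \/ Theta = Theta_minus,
         (w^-1 * Theta * w)%g = z
       & forall v : affine_perm n, (v^-1 * Theta * v)%g = z ->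
           (coxeter_length w <= coxeter_length v)%N]].

Definition fpf_length z : rat :=
  ((coxeter_length z)%:R - n%:R / 2%:R) / 2%:R.

Definition fpf_cover y z : Prop :=
  exists2 t, reflections t &
    z = (t * y * t)%g /\ fpf_length z = fpf_length y + 1.

End FPF.

(* Main.v *)
Require Import Defs.
From mathcomp Require Import all_boot all_order all_algebra.
From mathcomp Require Import boolp classical_sets functions.
From mathcomp Require Import zify lra.

(* Lengths are governed by inversions: for i < j, a reflection t_ij shortens w exactly when
   w i > w j.  Every fixed-point-free involution z = w^-1 Theta w has a conjugator of length
   (len z - len Theta) / 2, found by conjugating z down to Theta+ or Theta- along descents;
   as Theta+ and Theta- are not conjugate, this is the length of all atoms of z.
   If y = t z t with t = t_ij, then z and y differ in a way that only t and its twin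
   z t z = t_{z i, z j} can explain.  Since Theta inverts nothing but its own 2-cycles of
   adjacent integers, an atom of z inverts exactly one of the two twins, and removing that
   one gives the unique preimage. *)

Set Implicit Arguments.
Unset Strict Implicit.
Unset Printing Implicit Defensive.

Import Order.TTheory GRing.Theory Num.Theory.
Local Open Scope classical_set_scope.

Section AffinePermFacts.
Variable n : nat.
Hypothesis n_ge2 : (2 <= n)%N.
Local Open Scope ring_scope.
Implicit Types p q t v w z : affine_perm n.
Implicit Types i j k x y a : int.

(** * Congruence modulo [n] and the reflections [transp n i j] *)

Lemma eqmodP x i : reflect (exists a, x = i + a * n%:Z) (x == i %[mod n%:Z])%Z.
Proof.
rewrite eqz_mod_dvd; apply: (iffP dvdzP) => [[a /eqP]|[a ->]].
  by rewrite subr_eq addrC => /eqP ->; exists a.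
by exists a; rewrite addrAC subrr add0r.
Qed.

Lemma apermDM p i a : p (i + a * n%:Z) = p i + a * n%:Z.
Proof. by have [_ pn _] := aperm_axiom p; apply: periodicM. Qed.

Lemma apermVK p : cancel p (p^-1)%g.
Proof. by move=> i; rewrite -apermME mulVg. Qed.

Lemma apermKV p : cancel (p^-1)%g p.
Proof. by move=> i; rewrite -apermME mulgV. Qed.

Lemma aperm_inj p : injective p.
Proof. exact: can_inj (apermVK p). Qed.

Lemma aperm_shift p i j a : p i = p j + a * n%:Z -> i = j + a * n%:Z.
Proof. by rewrite -apermDM => /aperm_inj. Qed.

(** Congruence with an explicit quotient, so that multiples of [n] pass through permutations by
    [apermDM] and the rest is linear arithmetic. *)
Definition congr_mod i j := exists a, i = j + a * n%:Z.

Lemma transpC i j : transp n i j = transp n j i.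
Proof.
apply: aperm_ext => x; rewrite /= /transp_fun [(j == i %[mod _])%Z]eq_sym.
case: ifPn => // ij; case: ifPn => [/eqP xi|_]; case: ifPn => [/eqP xj|_] //.
- by move: ij; rewrite -xi -xj eqxx.
- lia.
- lia.
Qed.

Lemma transpL i j : ~ congr_mod i j -> transp n i j i = j.
Proof.
move=> ij; rewrite /= /transp_fun ifF; last by apply/negP => /eqmodP.
by rewrite eqxx addrC subrK.
Qed.

Lemma transpR i j : ~ congr_mod i j -> transp n i j j = i.
Proof.
rewrite transpC => ij; apply: transpL => -[a e]; apply: ij; exists (- a); lia.
Qed.

Lemma transp_moved i j x : transp n i j x <> x -> exists a,
  (x = i + a * n%:Z /\ transp n i j x = j + a * n%:Z) \/
  (x = j + a * n%:Z /\ transp n i j x = i + a * n%:Z).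
Proof.
rewrite /= /transp_fun; case: ifP => // _.
case: eqmodP => [[a ->] _|_]; first by exists a; left; split => //; lia.
by case: eqmodP => // -[a ->] _; exists a; right; split => //; lia.
Qed.

Lemma transp_fix i j x : ~ congr_mod x i -> ~ congr_mod x j -> transp n i j x = x.
Proof.
move=> xi xj; apply: contrapT => /transp_moved [a [[e _]|[e _]]].
  by apply: xi; exists a.
by apply: xj; exists a.
Qed.

Lemma transp_id i j : congr_mod i j -> transp n i j = 1%g.
Proof. by move=> /eqmodP ij; apply: aperm_ext => x; rewrite /= /transp_fun ij. Qed.

Lemma transp_conj p i j : (p * transp n i j = transp n (p i) (p j) * p)%g.
Proof.
have [ij|ij] := pselect (congr_mod i j).
  rewrite !transp_id ?mulg1 ?mul1g //.
  by case: ij => a ->; exists a; rewrite apermDM.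
have pij : ~ congr_mod (p i) (p j) by move=> [a /aperm_shift e]; apply: ij; exists a.
apply: aperm_ext => x; rewrite !apermME.
have [[a ->]|xi] := pselect (congr_mod x i); first by rewrite !apermDM !transpL.
have [[a ->]|xj] := pselect (congr_mod x j); first by rewrite !apermDM !transpR.
by rewrite !transp_fix// => -[a /aperm_shift e]; [apply: xi|apply: xj]; exists a.
Qed.

Lemma transpK i j : (transp n i j * transp n i j = 1)%g.
Proof.
have [ij|ij] := pselect (congr_mod i j); first by rewrite transp_id // mulg1.
apply: aperm_ext => x; rewrite !apermME aperm1E.
have [[a ->]|xi] := pselect (congr_mod x i); first by rewrite !apermDM transpL ?transpR.
have [[a ->]|xj] := pselect (congr_mod x j); first by rewrite !apermDM transpR ?transpL.
by rewrite !transp_fix.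
Qed.

(** Shifting both indices by the same multiple of [n], or exchanging them, gives the same
    reflection; so any moved point and its image can serve as indices. *)
Lemma transp_eval i j x : transp n i j x <> x ->
  transp n i j = transp n x (transp n i j x).
Proof.
have tr a : transp n i j = transp n (i + a * n%:Z) (j + a * n%:Z).
  have [ij|ij] := pselect (congr_mod i j).
    by rewrite !transp_id //; case: ij => b ->; exists b; lia.
  have ija : ~ congr_mod (i + a * n%:Z) (j + a * n%:Z).
    by move=> [b e]; apply: ij; exists b; lia.
  apply: aperm_ext => y.
  have [[b ->]|yi] := pselect (congr_mod y i).
    rewrite apermDM transpL // (_ : i + b * n%:Z = (i + a * n%:Z) + (b - a) * n%:Z); last lia.
    by rewrite apermDM transpL //; lia.
  have [[b ->]|yj] := pselect (congr_mod y j).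
    rewrite apermDM transpR // (_ : j + b * n%:Z = (j + a * n%:Z) + (b - a) * n%:Z); last lia.
    by rewrite apermDM transpR //; lia.
  by rewrite !transp_fix // => -[b e]; [apply: yi|apply: yj]; exists (b + a); lia.
move=> /transp_moved [a [[-> ->]|[-> ->]]]; first exact: tr.
by rewrite [RHS]transpC.
Qed.

Lemma simple_transpE k :
  exists2 m : nat, (1 <= m <= n)%N & transp n k (k + 1) = simple_transp n m.
Proof.
have n0 : n%:Z != 0 by lia.
exists (absz ((k - 1)%R %% n%:Z)%Z).+1.
  by have := ltz_pmod (k - 1) (d := n%:Z); have := modz_ge0 (k - 1) n0; lia.
have kk : ~ congr_mod k (k + 1) by move=> [[]a]; nia.
rewrite (@transp_eval _ _ (k - ((k - 1) %/ n%:Z)%Z * n%:Z)); last first.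
  rewrite -mulNr apermDM transpL //; lia.
rewrite -{2}mulNr apermDM transpL // mulNr /simple_transp.
have := divz_eq (k - 1) n%:Z; have := modz_ge0 (k - 1) n0.
case: (modz _ _) => // m _ e.
by congr transp; lia.
Qed.

Lemma simple_not_congr k : ~ congr_mod k (k + 1).
Proof. by move=> [[]a]; nia. Qed.

(** A simple transposition moves each point by at most one, so it can only reverse neighbours that
    it exchanges. *)
Lemma simple_order k x y : x < y -> transp n k (k + 1) y < transp n k (k + 1) x ->
  y = x + 1 /\ congr_mod x k.
Proof.
move=> xy sxy; set s := transp _ _ _ in sxy.
have hi a : s a = a \/ (s a = a + 1 /\ congr_mod a k) \/ (s a = a - 1).
  have [|/transp_moved] := pselect (s a = a); first by left.
  rewrite -/s => -[b [[-> ->]|[-> ->]]]; right; [left|right; lia].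
  by split; [lia|exists b].
have [ex|[[ex xk]|ex]] := hi x; have [ey|[[ey yk]|ey]] := hi y; try lia.
by split => //; lia.
Qed.

(** * Words in the generators: the exchange property, and a word for every element *)

Definition word_prod (u : seq nat) : affine_perm n := (\prod_(s <- u) simple_transp n s)%g.
Definition valid_word (u : seq nat) := all (fun i : nat => (1 <= i <= n)%N) u.

Lemma word_cons (i : nat) (u : seq nat) :
  word_prod (i :: u) = (simple_transp n i * word_prod u)%g.
Proof. by rewrite /word_prod big_cons. Qed.

(* If the order of the pair [i < j] is reversed, it is reversed by one letter, which
   then equals the conjugate of [transp n i j] by the letters to its right. *)
Lemma exchange (u : seq nat) i j : i < j -> word_prod u j < word_prod u i ->
  valid_word u ->
  exists u', [/\ valid_word u', (size u' < size u)%N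
                 & word_prod u' = (word_prod u * transp n i j)%g].
Proof.
move=> ij; elim: u => [|s u IH]; first by rewrite /word_prod big_nil !aperm1E; lia.
rewrite word_cons !apermME /= => + /andP[hs hu].
case: (ltgtP (word_prod u j) (word_prod u i)) => [pji _|pij sji|/aperm_inj]; last lia.
  have [u' [h1 h2 h3]] := IH pji hu; exists (s :: u'); split => //=; first exact/andP.
  by rewrite word_cons h3 mulgA.
exists u; split => //.
have [e1 [a e2]] := simple_order pij sji.
have -> : simple_transp n s = transp n (word_prod u i) (word_prod u j).
  rewrite /simple_transp (@transp_eval _ _ (word_prod u i)); last first.
    by rewrite e2 apermDM transpL; [lia|apply: simple_not_congr].
  rewrite {2}e2 apermDM transpL; last exact: simple_not_congr.
  by congr transp; lia.
by rewrite -mulgA transp_conj mulgA transpK mul1g.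
Qed.

(** A nonnegative measure that decreases when a descent is removed; it drives the induction of
    [word_exists], where lengths are not yet available. *)
Definition displacement (w : affine_perm n) : int :=
  \sum_(1 <= i < n.+1) (w i%:Z - i%:Z) ^+ 2.

Lemma displacement_ge0 w : 0 <= displacement w.
Proof. by apply: sumr_ge0 => i _; apply: sqr_ge0. Qed.

Lemma displacement_descent w (k : nat) : (1 <= k <= n)%N -> w (k%:Z + 1) < w k ->
  displacement (w * simple_transp n k)%g < displacement w.
Proof.
move=> hk wk; set s := simple_transp n k.
have sK x : s (s x) = x by rewrite -apermME transpK.
have [sb sn _] := aperm_axiom s; have [_ wn _] := aperm_axiom w.
rewrite -subr_gt0.
(* Reindexing by the involution [s] moves it from the argument of [w] to the subtracted term. *)
have -> : displacement (w * s)%g = \sum_(1 <= i < n.+1) (w i%:Z - s i%:Z) ^+ 2.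
  rewrite -(sum_periodic_reindex (g := fun i => (w i - s i) ^+ 2) sb sn).
    by apply: eq_bigr => i _; rewrite sK.
  by move=> i; rewrite wn sn; congr (_ ^+ 2); lia.
rewrite -sumrB.
pose c x := (x == k%:Z %[mod n%:Z])%Z.
(* The two sums differ only on the classes of [k] and [k + 1], where [h1] and [h2] are the
   contributions. Once [h2] is shifted by one they meet at [k], with total
   [2 * (w k - w (k + 1))]. *)
pose h1 x : int := if c x then (w x - x) ^+ 2 - (w x - x - 1) ^+ 2 else 0.
pose h2 x : int := if c (x - 1) then (w x - x) ^+ 2 - (w x - x + 1) ^+ 2 else 0.
have cn x : c (x + n%:Z) = c x by rewrite /c modzDr.
have sN x : congr_mod x k -> s x = x + 1.
  by move=> [a ->]; rewrite apermDM transpL; [lia|exact: simple_not_congr].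
have sN' x : congr_mod (x - 1) k -> s x = x - 1.
  move=> [a e]; have -> : x = k%:Z + 1 + a * n%:Z by lia.
  by rewrite apermDM transpR; [lia|exact: simple_not_congr].
have sF x : ~ congr_mod x k -> ~ congr_mod (x - 1) k -> s x = x.
  move=> nk nk1; apply: transp_fix => // -[a e]; apply: nk1; exists a; lia.
clearbody s.
have -> : \sum_(1 <= i < n.+1) ((w i%:Z - i%:Z) ^+ 2 - (w i%:Z - s i%:Z) ^+ 2) =
  \sum_(1 <= i < n.+1) h1 i%:Z + \sum_(1 <= i < n.+1) h2 i%:Z.
  rewrite -big_split /=; apply: eq_bigr => i _; rewrite /h1 /h2 /c.
  case: eqmodP => [ik|ik]; case: eqmodP => [ik1|ik1] /=.
  - by have := sN _ ik; rewrite (sN' _ ik1); lia.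
  - by rewrite sN // addr0; congr (_ - _ ^+ 2); lia.
  - by rewrite sN' // add0r; congr (_ - _ ^+ 2); lia.
  - by rewrite sF // subrr addr0.
rewrite -(sum_periodic_reindex (f := fun x => x + 1) (g := h2)); last first.
- by move=> x; rewrite /h2 addrAC cn wn; case: ifP => // _; congr (_ ^+ 2 - _ ^+ 2); lia.
- by move=> x; rewrite addrAC.
- by exists (fun x => x - 1) => x; rewrite ?addrK ?subrK.
rewrite -big_split /=.
have pos i : 0 <= h1 i + h2 (i + 1).
  rewrite /h1 /h2 addrK /c; case: eqmodP => [[a ->]|//].
  rewrite (_ : k%:Z + _ + 1 = k%:Z + 1 + a * n%:Z) ?apermDM; last lia.
  rewrite !expr2; nia.
have kn : k \in index_iota 1 n.+1 by rewrite mem_index_iota; lia.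
rewrite (bigD1_seq k kn (iota_uniq _ _)) /=.
apply: ltr_pwDl; last by apply: sumr_ge0.
by rewrite /h1 /h2 addrK /c eqxx !expr2; nia.
Qed.

(** [w] grows by at least one at each step, and a larger jump would skip a value, against
    surjectivity. So [w] is a translation, and the normalised sum forces it to be trivial. *)
Lemma increasing_aperm_eq1 w : (forall k, w k < w (k + 1)) -> w = 1%g.
Proof.
move=> incr.
have mono x (d : nat) : w x + d%:Z <= w (x + d%:Z).
  elim: d => [|d IH]; first by rewrite !addr0.
  have := incr (x + d%:Z); have -> : x + d.+1%:Z = x + d%:Z + 1 by lia.
  lia.
have wS k : w (k + 1) = w k + 1.
  apply/eqP; rewrite eq_le lezD1 incr andbT leNgt; apply/negP => gap.
  have := apermKV w (w k + 1); set x := (w^-1)%g _ => wx.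
  have [xk|kx] := lerP x k.
    by have := mono x (absz (k - x)%R); rewrite (_ : x + _ = k); lia.
  by have := mono (k + 1) (absz (x - (k + 1))%R); rewrite (_ : k + 1 + _ = x); lia.
have [_ _ /sum_dispP ws] := aperm_axiom w.
have wE (i : nat) : w i%:Z = i%:Z + w 0.
  by elim: i => [|i IH]; [rewrite add0r|rewrite intSr wS IH; lia].
have w0 : w 0 = 0.
  move: ws; under eq_bigr => i _ do rewrite wE addrC addKr.
  by rewrite sumr_const_nat subSS subn0 => /eqP; rewrite mulrn_eq0; lia.
have w0S (i : nat) : w (- i%:Z) = - i%:Z.
  elim: i => [|i IH]; first by rewrite oppr0 w0.
  by have := wS (- i.+1%:Z); rewrite (_ : - _ + 1 = - i%:Z) ?IH; lia.
apply: aperm_ext => x; rewrite aperm1E; case: (intP x) => [//|i|i].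
  by rewrite wE w0 addr0.
by rewrite w0S.
Qed.

Lemma simple_all_descent w : (forall k : nat, (1 <= k <= n)%N -> w k < w (k%:Z + 1)) ->
  forall k, w k < w (k + 1).
Proof.
move=> incr k; have n0 : n%:Z != 0 by lia.
have := incr (absz ((k - 1)%R %% n%:Z)%Z).+1.
have := ltz_pmod (k - 1) (d := n%:Z); have := modz_ge0 (k - 1) n0.
have := divz_eq (k - 1) n%:Z; set a := divz _ _; case: (modz _ _) => // m e _ m_lt /=.
rewrite (_ : k = m.+1%:Z + a * n%:Z); last lia.
have -> : m.+1%:Z + a * n%:Z + 1 = m.+1%:Z + 1 + a * n%:Z by lia.
rewrite !apermDM => /(_ _); lia.
Qed.

Lemma word_exists w : exists2 u, valid_word u & w = word_prod u.
Proof.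
have [N] := ubnP (absz (displacement w)); elim: N w => // N IH w wN.
have [incr|] := pselect (forall k : nat, (1 <= k <= n)%N -> w k < w (k%:Z + 1)).
  exists [::] => //; rewrite /word_prod big_nil.
  exact/increasing_aperm_eq1/simple_all_descent.
move=> /existsNP [k /not_implyP [hk /negP]]; rewrite -leNgt le_eqVlt => /orP[/eqP|wk].
  by move=> /aperm_inj; lia.
have d1 := displacement_descent hk wk; have d2 := displacement_ge0 w.
have d3 := displacement_ge0 (w * simple_transp n k)%g.
have [|u hu e] := IH (w * simple_transp n k)%g; first lia.
exists (rcons u k); first by rewrite /valid_word all_rcons hk.
by rewrite /word_prod -cats1 big_cat big_seq1 /= -/(word_prod u) -e -mulgA transpK mulg1.
Qed.

(** * The length function and its change under a reflection *)

Local Notation len := (@coxeter_length n).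

(** Every element has a word, so the minimum exists and [xget] returns it rather than its
    default. *)
Lemma coxeter_lengthP w : (exists u, [/\ size u = len w, valid_word u & w = word_prod u]) /\
  forall u, valid_word u -> w = word_prod u -> (len w <= size u)%N.
Proof.
have : exists k : nat, word_lengths w k /\ forall m, word_lengths w m -> (k <= m)%N.
  have [u hu e] := word_exists w.
  have ex : exists m, `[< word_lengths w m >].
    by exists (size u); apply/asboolP; exists u.
  exists (ex_minn ex); case: ex_minnP => m /asboolP hm min; split => // k hk.
  by apply: min; apply/asboolP.
move=> /(xgetPex 0%N) [ex min]; split => // u hu e.
by apply: min; exists u.
Qed.

Lemma len_mul w v : (len (w * v)%g <= len w + len v)%N.
Proof.
have [[u [<- hu {2}->]] _] := coxeter_lengthP w.
have [[u' [<- hu' {2}->]] _] := coxeter_lengthP v.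
rewrite -size_cat; apply: (coxeter_lengthP _).2.
  by rewrite /valid_word all_cat; apply/andP.
by rewrite /word_prod big_cat.
Qed.

Lemma len1 : len 1%g = 0%N.
Proof.
apply/eqP; rewrite -leqn0; apply: ((coxeter_lengthP _).2 [::]) => //.
by rewrite /word_prod big_nil.
Qed.

Lemma lenV w : len (w^-1)%g = len w.
Proof.
suff h v : (len (v^-1)%g <= len v)%N by apply/eqP; rewrite eqn_leq h -{1}[w]invgK h.
have [[u [<- hu {2}->]] _] := coxeter_lengthP v.
rewrite -(size_rev u); apply: (coxeter_lengthP _).2; first by rewrite /valid_word all_rev.
elim: u {hu} => [|k u IH]; first by rewrite /word_prod big_nil invg1.
rewrite word_cons invgM IH rev_cons /word_prod -cats1 big_cat big_seq1 /=.
by congr (_ * _)%g; apply: mulg1_eq; apply: transpK.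
Qed.

Lemma len_simple (k : int) : (len (transp n k (k + 1)) <= 1)%N.
Proof.
have [m hm ->] := simple_transpE k; apply: ((coxeter_lengthP _).2 [:: m]).
  by rewrite /valid_word /= hm.
by rewrite /word_prod big_seq1.
Qed.

Lemma len_transp_lt w i j : i < j -> w j < w i -> (len (w * transp n i j)%g < len w)%N.
Proof.
move=> ij wij; have [[u [<- hu e]] _] := coxeter_lengthP w.
have [|u' [hu' lt e']] := exchange ij _ hu; first by rewrite -e.
by apply: leq_ltn_trans lt; apply: (coxeter_lengthP _).2 => //; rewrite e'  e.
Qed.

(** In [w * transp n i j] the pair is inverted, so [len_transp_lt] applies there and leads back to
    [w]. *)
Lemma len_transp_gt w i j : ~ congr_mod i j -> i < j -> w i < w j ->
  (len w < len (w * transp n i j)%g)%N.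
Proof.
move=> nij ij wij; have := @len_transp_lt (w * transp n i j)%g i j ij.
by rewrite -mulgA transpK mulg1 !apermME transpL // transpR //; apply.
Qed.

(** * Conjugating a fixed-point-free involution by a reflection *)

Local Notation fpf := (@fpf_involutions n).

Lemma transpV i j : ((transp n i j)^-1 = transp n i j)%g.
Proof. by apply: mulg1_eq; apply: transpK. Qed.

Lemma conj_transpK i j w :
  (transp n i j * (transp n i j * w * transp n i j) * transp n i j = w)%g.
Proof. by rewrite !mulgA transpK mul1g -mulgA transpK mulg1. Qed.

Lemma transp_not_congr i j x : transp n i j x <> x -> ~ congr_mod (transp n i j x) x.
Proof.
move=> tx; have [ij|ij] := pselect (congr_mod i j).
  by case: tx; rewrite transp_id.
have [a [[-> ->]|[-> ->]]] := transp_moved tx => -[b e]; apply: ij.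
  by exists (- b); lia.
by exists b; lia.
Qed.

Lemma fpf_mul z : fpf z -> (z * z = 1)%g.
Proof. by move=> zf; apply: aperm_ext => x; rewrite apermME (zf x).1. Qed.

Lemma fpf_not_congr z i : fpf z -> ~ congr_mod (z i) i.
Proof.
move=> zf [a e]; have := (zf i).1; rewrite {1}e apermDM => e2.
by apply: (zf i).2; lia.
Qed.

Lemma fpf_shift z i j a : fpf z -> z i = j + a * n%:Z -> z j = i - a * n%:Z.
Proof.
move=> zf e; have := (zf i).1; rewrite e apermDM => e2; lia.
Qed.

Lemma fpf_conj z v : fpf z -> fpf (v^-1 * z * v)%g.
Proof.
move=> zf x; rewrite !apermME apermKV (zf _).1 apermVK; split => // e.
by apply: (zf (v x)).2; rewrite -{2}e apermKV.
Qed.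

(** Two strict increases: from [z] to [z * t], whose inverse is [t * z], and from [t * z] to
    [t * z * t]. *)
Lemma len_fpf_conj_up z i j : fpf z -> ~ congr_mod i j -> i < j -> z i < z j ->
  (len z + 2 <= len (transp n i j * z * transp n i j)%g)%N.
Proof.
move=> zf nij ij zij; set t := transp n i j.
have up1 : (len z < len (z * t)%g)%N by exact: len_transp_gt.
have -> : (t * z * t = (t * z^-1 * t)^-1)%g.
  by rewrite !invgM invgK transpV mulgA.
rewrite lenV; have zV : (z^-1 = z)%g by apply: mulg1_eq; apply: fpf_mul.
have e : len (t * z)%g = len (z * t)%g by rewrite -lenV invgM transpV zV.
suff : (len (t * z)%g < len (t * z * t)%g)%N by rewrite zV; lia.
apply: len_transp_gt => //; rewrite !apermME.
(* [t] can disturb [z i] and [z j] only if [z i] is congruent to [j], because [z i] is never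
   congruent to [i]; then [z j] is known as well and the order is checked directly. *)
have [fi|mi] := pselect (t (z i) = z i); last first.
  have [a [[e1 e2]|[e1 e2]]] := transp_moved mi.
    by case: (fpf_not_congr (i := i) zf); exists a.
  have e3 := fpf_shift zf e1.
  have e4 : t (z j) = j - a * n%:Z by rewrite e3 -mulNr apermDM transpL.
  by rewrite e2 e4; lia.
have [fj|mj] := pselect (t (z j) = z j); first by rewrite fi fj.
have [a [[e1 e2]|[e1 e2]]] := transp_moved mj; last first.
  by case: (fpf_not_congr (i := j) zf); exists a.
have e3 := fpf_shift zf e1.
by move: fi; rewrite e3 -mulNr apermDM transpR //; lia.
Qed.

(** If [t (z j) = z i] held, [t] would be the reflection exchanging [z i] and [z j], that is, its
    own conjugate by [z], and so would commute with [z]. *)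
Lemma transp_conj_moved z i j : fpf z -> ~ congr_mod i j ->
  (transp n i j * z * transp n i j)%g <> z -> transp n i j (z j) <> z i.
Proof.
move=> zf nij tz e; apply: tz; set t := transp n i j in e *.
have tm : t (z j) <> z j.
  by rewrite e => /aperm_inj ij; apply: nij; exists 0; lia.
have te : t = transp n (z i) (z j) by rewrite {1}/t (transp_eval tm) -/t e transpC.
have : (z * t = t * z)%g by rewrite {1}/t transp_conj -te.
by move=> h; rewrite -h -mulgA transpK mulg1.
Qed.

(* A reflection moving [x] is determined by the image of [x]; evaluating the equation
   at [i] leaves only two possible values for [transp n k l]. *)
Lemma transp_conj_eq z i j k l : fpf z -> ~ congr_mod i j ->
  (transp n i j * z * transp n i j)%g <> z ->
  (transp n i j * z * transp n i j = transp n k l * z * transp n k l)%g ->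
  transp n k l = transp n i j \/ transp n k l = transp n (z i) (z j).
Proof.
move=> zf nij tz; have := transp_conj_moved zf nij tz.
move=> yi /(congr1 (fun p : affine_perm n => p i)).
have ti : transp n i j i = j by exact: transpL.
rewrite !apermME ti; set t' := transp n k l.
have zmoved x y c : z x = y + c * n%:Z -> x = z y + c * n%:Z.
  by move=> e; rewrite -apermDM -e (zf x).1.
have tmoved : transp n i j (z j) <> z j ->
    exists a, z j = i + a * n%:Z /\ transp n i j (z j) = j + a * n%:Z.
  move=> /transp_moved [a [[e1 e2]|[e1 e2]]]; first by exists a.
  by case: (fpf_not_congr (i := j) zf); exists a.
have [t'i|t'i] := pselect (t' i = i).
  rewrite t'i => E.
  have t'z : t' (z i) <> z i by rewrite -E.
  right; rewrite {1}/t' (transp_eval t'z) -/t'.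
  have [f|/tmoved [a [e1 e2]]] := pselect (transp n i j (z j) = z j).
    by rewrite -E f.
  case: (transp_not_congr t'z); exists (2 * a); rewrite -/t' -E e2.
  by have := zmoved _ _ _ e1; lia.
move=> E; left.
have ne := transp_not_congr t'i.
have t'E : t' = transp n i (t' i) by rewrite {1}/t' (transp_eval t'i).
move: (t' i) ne t'i t'E E => m ne mi -> E.
suff -> : m = j by [].
have t'moved : transp n i m (z m) <> z m ->
    exists a, z m = i + a * n%:Z /\ transp n i m (z m) = m + a * n%:Z.
  move=> /transp_moved [a [[e1 e2]|[e1 e2]]]; first by exists a.
  by case: (fpf_not_congr (i := m) zf); exists a.
have [f|/tmoved [a [e1 e2]]] := pselect (transp n i j (z j) = z j);
  have [g|/t'moved [b [e3 e4]]] := pselect (transp n i m (z m) = z m).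
- by move: E; rewrite f g => /aperm_inj.
- case: nij; exists (- (2 * b)); move: E; rewrite f e4 => E.
  by have := zmoved _ _ _ E; lia.
- case: ne; exists (2 * a); move: E; rewrite e2 g => /esym E.
  by have := zmoved _ _ _ E; lia.
- have := zmoved _ _ _ e1; have := zmoved _ _ _ e3; lia.
Qed.

(* Conjugation by [transp n i j] sends [z] to [z * r1 * r2], where the reflections
   [r1] and [r2] both increase the length. *)
Lemma len_fpf_conj_long z i j a : fpf z -> ~ congr_mod i j -> i < j ->
  z i = j + a * n%:Z -> a < 0 -> z j < z i ->
  (len z + 2 <= len (transp n i j * z * transp n i j)%g)%N.
Proof.
move=> zf nij ij zi a0 zji; have zj := fpf_shift zf zi.
have n0 : n%:Z != 0 by lia.
have := divz_eq (j - i) n%:Z; have := modz_ge0 (j - i) n0.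
have : ((j - i) %% n%:Z)%Z < n%:Z by apply: ltz_pmod; lia.
set b := divz _ _; set r := modz _ _ => r_lt r_ge d.
have r_gt : 0 < r.
  by rewrite lt_neqAle r_ge andbT; apply/eqP => r0; apply: nij; exists (- b); lia.
(* The shift [b] satisfies [b * n < j - i < (b - 2 * a) * n]: the right inequality makes the first
   reflection lengthen, the left one the second. *)
pose j1 := j + b * n%:Z; pose j2 := j + (b - 2 * a) * n%:Z.
have nij1 : ~ congr_mod i j1 by move=> [c e]; apply: nij; exists (c + b); lia.
have nij2 : ~ congr_mod i j2 by move=> [c e]; apply: nij; exists (c + b - 2 * a); lia.
have An : a * n%:Z <= - n%:Z by nia.
have zj1 : z j1 = i + (b - a) * n%:Z by rewrite /j1 apermDM zj; lia.
have u1 : (len z < len (z * transp n i j1)%g)%N.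
  by apply: len_transp_gt => //; rewrite ?zi ?zj1 /j1; lia.
have r1j2 : transp n i j1 j2 = i - (2 * a) * n%:Z.
  have -> : j2 = j1 + (- (2 * a)) * n%:Z by rewrite /j2 /j1; lia.
  by rewrite apermDM transpR //; lia.
have zr1j2 : z (transp n i j1 j2) = j - a * n%:Z.
  by rewrite r1j2 -mulNr apermDM zi; lia.
have u2 : (len (z * transp n i j1)%g < len (z * transp n i j1 * transp n i j2)%g)%N.
  by apply: len_transp_gt => //; rewrite ?apermME ?zr1j2 ?transpL // ?zj1 /j2; lia.
suff -> : (transp n i j * z * transp n i j = z * transp n i j1 * transp n i j2)%g by lia.
apply: aperm_ext => x; rewrite !apermME.
have [[c ->]|xi] := pselect (congr_mod x i).
  by rewrite !apermDM !transpL // zr1j2 zj -mulNr apermDM transpL //; lia.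
have [[c ->]|xj] := pselect (congr_mod x j).
  rewrite !apermDM transpR // zi apermDM transpR //.
  have -> : transp n i j2 j = i + (2 * a - b) * n%:Z.
    have -> : j = j2 + (2 * a - b) * n%:Z by rewrite /j2; lia.
    by rewrite apermDM transpR.
  rewrite apermDM transpL // (_ : j1 + _ = j + (2 * a) * n%:Z); last by rewrite /j1; lia.
  by rewrite apermDM zj; lia.
have xj1 : ~ congr_mod x j1 by move=> [c e]; apply: xj; exists (c + b); rewrite e /j1; lia.
have xj2 : ~ congr_mod x j2.
  by move=> [c e]; apply: xj; exists (c + b - 2 * a); rewrite e /j2; lia.
rewrite (transp_fix xi xj) (transp_fix xi xj2) (transp_fix xi xj1) transp_fix //.
- by move=> [c e]; apply: xj; exists (c + a); have := fpf_shift zf e; rewrite zi; lia.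
- by move=> [c e]; apply: xi; exists (c - a); have := fpf_shift zf e; rewrite zj; lia.
Qed.

Lemma reflections_transp i j : i < j -> ~ congr_mod i j -> reflections (transp n i j).
Proof.
move=> ij nij; exists i, j; split=> //; apply/negP => /eqmodP [a e]; apply: nij.
by exists (- a); lia.
Qed.

Lemma reflectionsP t : reflections t <->
  exists i j, [/\ i < j, ~ congr_mod i j & t = transp n i j].
Proof.
split=> [[i [j [ij /negP nij ->]]]|[i [j [ij nij ->]]]]; last exact: reflections_transp.
exists i, j; split=> // -[a e]; apply: nij; apply/eqmodP; exists (- a); lia.
Qed.

Lemma conj_transp_eq z w i j : (z = transp n i j * w * transp n i j)%g ->
  (w = transp n i j * z * transp n i j)%g.
Proof. by move=> ->; rewrite conj_transpK. Qed.

Lemma fpf_length_cover z w : fpf_length z = fpf_length w + 1 -> len z = (len w + 2)%N.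
Proof.
rewrite /fpf_length => e; apply/eqP; rewrite -(eqr_nat rat) natrD; apply/eqP; lra.
Qed.

(** Here [t] commutes with its twin [t' = z * t * z], and [z * t' = t * z], so [t' * z * t' = t' * t
    * z = t * t' * z = t * z * t]. *)
Lemma twin_reflection_conj z i j :
  fpf z -> transp n i j (z i) = z i -> transp n i j (z j) = z j ->
  (transp n (z i) (z j) * z * transp n (z i) (z j) = transp n i j * z * transp n i j)%g.
Proof.
move=> zf ti tj; set t := transp n i j; set t' := transp n (z i) (z j).
have tt' : (t * t' = t' * t)%g by rewrite /t' transp_conj -/t ti tj.
have zt : (z * t = t' * z)%g by exact: transp_conj.
have zt' : (z * t' = t * z)%g.
  by rewrite /t' transp_conj !(zf _).1.
by rewrite -mulgA zt' -[RHS]mulgA zt !mulgA tt'.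
Qed.

(** * The involutions [Theta]: explicit values and non-conjugacy *)

Lemma prod_simple_fix (r : seq nat) (P : pred nat) x :
  (forall m, m \in r -> P m -> simple_transp n m x = x) ->
  (\prod_(m <- r | P m) simple_transp n m)%g x = x.
Proof.
elim: r => [|m r IH] h; first by rewrite big_nil.
have hr m' : m' \in r -> P m' -> simple_transp n m' x = x.
  by move=> mr; apply: h; rewrite inE mr orbT.
rewrite big_cons; case: ifP => Pm; last exact: IH.
by rewrite apermME IH // h ?mem_head.
Qed.

(** The last hypothesis, with the letters distinct modulo [n], keeps the other factors away from [x]
    and [x + 1]: splitting the product at [m] leaves a single factor that moves them. *)
Lemma prod_simple_swap (P : pred nat) (m : nat) x :
  (1 <= m <= n)%N -> P m -> congr_mod x m ->
  (forall k : nat, (1 <= k <= n)%N -> P k ->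
     ~ congr_mod x (k%:Z + 1) /\ ~ congr_mod (x + 1) k) ->
  let T := (\prod_(1 <= k < n.+1 | P k) simple_transp n k)%g in
  T x = x + 1 /\ T (x + 1) = x.
Proof.
move=> hm Pm xm hP T.
have kn : m \in index_iota 1 n.+1 by rewrite mem_index_iota; lia.
have hr (k : nat) : k \in index_iota 1 n.+1 -> (1 <= k <= n)%N by rewrite mem_index_iota; lia.
have hu := iota_uniq 1 n; rewrite /T; move: hu hr.
rewrite (_ : iota 1 n = index_iota 1 n.+1); last by rewrite /index_iota subn1.
case/splitPr: kn => r1 r2.
rewrite cat_uniq => /and3P [_ hu1 /= /andP [hu2 _]] hr.
have mr1 : m \notin r1 by apply: contra hu1 => h; apply/hasP; exists m; rewrite ?mem_head.
have fix0 (k : nat) : k \in r1 \/ k \in r2 -> P k ->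
    simple_transp n k x = x /\ simple_transp n k (x + 1) = x + 1.
  move=> kr Pk.
  have km : k <> m by move=> e; case: kr; rewrite e; apply/negP.
  have hk : (1 <= k <= n)%N.
    by apply: hr; rewrite mem_cat inE; case: kr => ->; rewrite ?orbT.
  have nxk : ~ congr_mod x k.
    move=> [a ea]; have [b eb] := xm; apply: km.
    have : (b - a) * n%:Z = k%:Z - m%:Z by lia.
    by case: (ltrgtP (b - a) 0) => ba; nia.
  have [h1 h2] := hP k hk Pk.
  split; apply: transp_fix => //.
  by move=> [a e]; apply: nxk; exists a; lia.
have [a ea] := xm.
have sx : simple_transp n m x = x + 1.
  by rewrite ea apermDM transpL; [lia|apply: simple_not_congr].
have sx1 : simple_transp n m (x + 1) = x.
  have -> : x + 1 = m%:Z + 1 + a * n%:Z by lia.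
  by rewrite apermDM transpR; [lia|apply: simple_not_congr].
have -> : (\prod_(k <- r1 ++ m :: r2 | P k) simple_transp n k =
    \prod_(k <- r1 | P k) simple_transp n k *
    (simple_transp n m * \prod_(k <- r2 | P k) simple_transp n k))%g.
  by rewrite big_cat big_cons Pm.
rewrite !apermME.
have fixes (r : seq nat) : (forall k : nat, k \in r -> k \in r1 \/ k \in r2) ->
    (\prod_(k <- r | P k) simple_transp n k)%g x = x /\
    (\prod_(k <- r | P k) simple_transp n k)%g (x + 1) = x + 1.
  by move=> rr; split; apply: prod_simple_fix => k /rr kr /(fix0 k kr) [].
have [|p1 p1'] := fixes r1; first by left.
have [|p2 p2'] := fixes r2; first by right.
by rewrite p2 p2' sx sx1 p1 p1'.
Qed.

Hypothesis n_even : ~~ odd n.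

(** Indexed by the parity of the letters, so that both involutions are handled by comparing this
    boolean with the parity of an integer. *)
Definition Theta (b : bool) : affine_perm n :=
  (\prod_(1 <= k < n.+1 | odd k == b) simple_transp n k)%g.

Lemma Theta_true : Theta true = Theta_plus n.
Proof. by apply: eq_bigl => k; rewrite eqb_id. Qed.

Lemma Theta_false : Theta false = Theta_minus n.
Proof. by apply: eq_bigl => k; rewrite eqbF_neg. Qed.

Lemma int_odd_shift x a : odd (absz (x + a * n%:Z)%R) = odd (absz x).
Proof.
have -> : n = (n./2 + n./2)%N by lia.
have -> : x + a * (n./2 + n./2)%:Z = x + a * (n./2)%:Z + a * (n./2)%:Z by lia.
move: (a * _) => c; lia.
Qed.

Lemma Theta_swap (b : bool) x : odd (absz x) = b -> Theta b x = x + 1 /\ Theta b (x + 1) = x.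
Proof.
move=> xb; have n0 : n%:Z != 0 by lia.
have := ltz_pmod (x - 1) (d := n%:Z); have := modz_ge0 (x - 1) n0.
have := divz_eq (x - 1) n%:Z; set a := divz _ _; case: (modz _ _) => // m e _ m_lt.
have xm : congr_mod x m.+1%:Z by exists a; lia.
apply: (prod_simple_swap (m := m.+1)) => //.
- lia.
- by case: xm => c ec; rewrite -xb ec int_odd_shift; apply/eqP.
- move=> k _ /eqP kb; split=> -[c ec].
    have := int_odd_shift (k%:Z + 1) c; rewrite -ec; lia.
  have := int_odd_shift k c; rewrite -ec; lia.
Qed.

Lemma ThetaE b x : Theta b x = if odd (absz x) == b then x + 1 else x - 1.
Proof.
case: eqP => xb; first by have [] := Theta_swap xb.
have [|_] := @Theta_swap b (x - 1); first by lia.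
by have -> : x - 1 + 1 = x by lia.
Qed.

Lemma Theta_fpf b : fpf (Theta b).
Proof. by move=> x; rewrite !ThetaE; split; repeat case: ifP; lia. Qed.

Lemma Theta_inversion b x y : x < y -> Theta b y < Theta b x ->
  y = x + 1 /\ Theta b x = y.
Proof. by move=> xy; rewrite !ThetaE; repeat case: ifP; lia. Qed.

Lemma sum_pairs_even (f : nat -> int) (h : nat) :
  (forall k : nat, odd k -> f k.+1 = f k) ->
  exists s, \sum_(1 <= k < h.*2.+1) f k = s + s.
Proof.
move=> fS; elim: h => [|h [s IH]]; first by exists 0; rewrite big_geq.
exists (s + f h.*2.+1); rewrite doubleS big_nat_recr //= big_nat_recr //= IH.
by rewrite (fS h.*2.+1) /= ?odd_double // -addrA addrACA.
Qed.

(* Write [c x = x + Theta x].  Since [c] is n-periodic up to 2n, the sum over one period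
   of [c (w i) %/ 2n] does not depend on [w]; grouping it by the cycles of [Theta true]
   for [w = 1] and of [Theta false] for a hypothetical conjugator [w] gives different
   parities. *)
Lemma Theta_not_conj w : (Theta true * w)%g <> (w * Theta false)%g.
Proof.
move=> wT.
set T := Theta true in wT; set T' := Theta false in wT.
have Tw x : T (w x) = w (T' x) by rewrite -apermME wT.
pose N : int := 2 * n%:Z; pose c x : int := x + T x.
have N0 : N != 0 by rewrite /N; lia.
have Tn p x : p (x + n%:Z) = p x + n%:Z by have [_ ->] := aperm_axiom p.
pose q x := (c x %/ N)%Z.
have qn x : q (x + n%:Z) = q x + 1.
  rewrite /q /c Tn (_ : x + n%:Z + _ = 1 * N + (x + T x)); last by rewrite /N; lia.
  by rewrite divzMDl // addrC.
have qT x : q (T x) = q x.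
  by rewrite /q /c; have [-> _] := Theta_fpf true x; rewrite addrC.
have disp p : \sum_(1 <= i < n.+1) (p i%:Z - i%:Z) = 0.
  by have [_ _ /sum_dispP] := aperm_axiom p.
have [wb wn _] := aperm_axiom w; have [T'b T'n _] := aperm_axiom T'.
have sum_c : \sum_(1 <= i < n.+1) (c (w i%:Z) - c i%:Z) = 0.
  have -> : \sum_(1 <= i < n.+1) (c (w i%:Z) - c i%:Z) =
    \sum_(1 <= i < n.+1) (w i%:Z - i%:Z) + \sum_(1 <= i < n.+1) (w (T' i%:Z) - T' i%:Z)
    + \sum_(1 <= i < n.+1) (T' i%:Z - i%:Z) - \sum_(1 <= i < n.+1) (T i%:Z - i%:Z).
    by rewrite -!big_split -sumrB /=; apply: eq_bigr => i _; rewrite /c Tw; lia.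
  rewrite (sum_periodic_reindex (g := fun x => w x - x) T'b T'n) ?disp //.
  exact: disp_periodic.
have sum_m : \sum_(1 <= i < n.+1) ((c (w i%:Z) %% N)%Z - (c i%:Z %% N)%Z) = 0.
  rewrite sumrB (sum_periodic_reindex (g := fun x => (c x %% N)%Z) wb wn) ?subrr //.
  by move=> x; rewrite /c Tn (_ : x + n%:Z + _ = 1 * N + (x + T x)) ?modzMDl // /N; lia.
have sum_q : \sum_(1 <= i < n.+1) (q (w i%:Z) - q i%:Z) = 0.
  have : N * \sum_(1 <= i < n.+1) (q (w i%:Z) - q i%:Z) = 0.
    transitivity (\sum_(1 <= i < n.+1) (c (w i%:Z) - c i%:Z) -
      \sum_(1 <= i < n.+1) ((c (w i%:Z) %% N)%Z - (c i%:Z %% N)%Z)); last first.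
      by rewrite sum_c sum_m.
    rewrite mulr_sumr -sumrB.
    apply: eq_bigr => i _; have := divz_eq (c (w i%:Z)) N; have := divz_eq (c i%:Z) N.
    by rewrite -/(q _) -/(q _); lia.
  by move/eqP; rewrite mulf_eq0 (negPf N0) => /eqP.
have n2 : n = (n./2).*2 by lia.
have [s1 e1] : exists s, \sum_(1 <= i < n.+1) q i%:Z = s + s.
  rewrite [in n.+1]n2; apply: sum_pairs_even => k hk.
  rewrite intSr -(qT k%:Z) /T ThetaE ifT //; apply/eqP; exact: hk.
(* [Theta false] pairs each even number with its successor, so the sum now runs over the window from
   2 to [n + 1]. Moving the window by one step raises the sum by exactly one, which breaks the
   parity. *)
have [s2 e2] : exists s, \sum_(1 <= i < n.+1) q (w i.+1%:Z) = s + s.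
  rewrite [in n.+1]n2; apply: sum_pairs_even => k hk.
  rewrite -(qT (w k.+1%:Z)) Tw /T' ThetaE ifT; last by apply/eqP => /=; lia.
  by congr (q (w _)); lia.
have : \sum_(1 <= i < n.+1) (q (w i.+1%:Z) - q (w i%:Z)) = 1.
  rewrite telescope_sumr; last lia.
  have -> : n.+1%:Z = 1%N%:Z + n%:Z by lia.
  by rewrite wn qn addrC addKr.
move: sum_q; rewrite !sumrB e1 e2; lia.
Qed.

(** * Descent to [Theta] by conjugation, and the length of atoms *)

Lemma Theta_conj_eq b b' w : (w^-1 * Theta b * w)%g = Theta b' -> b = b'.
Proof.
case: b b' => -[] // e; exfalso.
  by apply: (@Theta_not_conj w); rewrite -e !mulgA mulgV mul1g.
by apply: (@Theta_not_conj (w^-1)%g); rewrite -e -!mulgA mulgV mulg1.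
Qed.

(** If [z x > x + 1], no permitted descent can occur from [x] on, so [z] keeps growing and
    [z (z x) = x] fails. Hence [z] moves every point by one, in alternating directions. *)
Lemma fpf_no_descent z : fpf z -> (forall k, z (k + 1) < z k -> z k = k + 1) ->
  exists b, z = Theta b.
Proof.
move=> zf nd.
have le1 x : z x <= x + 1.
  rewrite leNgt; apply/negP => gt1.
  have up (d : nat) : z x + d%:Z <= z (x + d%:Z).
    elim: d => [|d IH]; first by rewrite !addr0.
    have -> : x + d.+1%:Z = x + d%:Z + 1 by lia.
    have [/nd|] := ltrP (z (x + d%:Z + 1)) (z (x + d%:Z)); first lia.
    rewrite le_eqVlt => /orP[/eqP/aperm_inj|]; lia.
  have := up (absz (z x - x)%R); have -> : x + (absz (z x - x)%R)%:Z = z x by lia.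
  by rewrite (zf x).1; lia.
have near x : z x = x + 1 \/ z x = x - 1.
  have := le1 x; have := le1 (z x); rewrite (zf x).1; have := (zf x).2; lia.
have alt x : (z (x + 1) == x + 1 + 1) = ~~ (z x == x + 1).
  apply/eqP/negP => [e /eqP e1|ne].
    by have := (zf x).1; rewrite e1 e; lia.
  have [//|e] := near (x + 1); case: ne; apply/eqP.
  by have := (zf (x + 1)).1; rewrite e; have -> : x + 1 - 1 = x by lia.
(* [Theta true] sends the even number 0 to -1 and [Theta false] sends it to 1. *)
pose b := z 0 != 1; exists b; apply: aperm_ext => x.
suff e : (z x == x + 1) = (odd (absz x) == b).
  by rewrite ThetaE -e; case: eqP => // ne; have [] := near x.
have pos (m : nat) : (z m == m%:Z + 1) = (odd m == b).
  elim: m => [|m IH]; first by rewrite add0r /b; case: eqP.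
  by rewrite intSr alt IH /=; case: (odd m) (b) => -[].
have neg (m : nat) : (z (- m%:Z) == - m%:Z + 1) = (odd m == b).
  elim: m => [|m IH]; first by rewrite oppr0 pos.
  have := alt (- m.+1%:Z); have -> : - m.+1%:Z + 1 = - m%:Z by lia.
  by rewrite IH /=; case: (z _ == _); case: (odd m) (b) => -[].
by case: (intP x) => [|m|m]; rewrite ?pos ?neg //.
Qed.

(** Unless [z] exchanges [k] and [k + 1], the conjugate has an ascent at [k], so [len_fpf_conj_up]
    applies to it. *)
Lemma len_fpf_conj_descent z k : fpf z -> z (k + 1) < z k -> z k <> k + 1 ->
  (len (transp n k (k + 1) * z * transp n k (k + 1))%g + 2 <= len z)%N.
Proof.
move=> zf desc nk; set s := transp n k (k + 1).
have nk1 := @simple_not_congr k.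
have szf : fpf (s * z * s)%g by have := @fpf_conj z s zf; rewrite /s transpV.
rewrite -{2}(conj_transpK k (k + 1) z); apply: len_fpf_conj_up => //; first lia.
rewrite !apermME transpL // transpR // ltNge le_eqVlt; apply/negP => /orP[/eqP|].
  by move=> /aperm_inj /aperm_inj; lia.
move=> /(simple_order desc) [e1 [a e2]]; apply: nk.
by have := fpf_shift (j := k) zf e2; lia.
Qed.

(** Each conjugation along a descent takes at least two from the length of [z] and adds at most one
    to the conjugator. The descent ends at some [Theta b'], where [Theta_conj_eq] gives [b' = b]. *)
Lemma exists_short_conjugator b w : exists v,
  (v^-1 * Theta b * v = w^-1 * Theta b * w)%g /\
  (2 * len v + len (Theta b) <= len (w^-1 * Theta b * w)%g)%N.
Proof.
have [N] := ubnP (len (w^-1 * Theta b * w)%g); elim: N w => // N IH w.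
set z := (w^-1 * Theta b * w)%g => zN.
have zf : fpf z by apply/fpf_conj/Theta_fpf.
have [nd|] := pselect (forall k, z (k + 1) < z k -> z k = k + 1).
  have [b' zb] := fpf_no_descent zf nd.
  have bb := Theta_conj_eq zb; exists 1%g.
  by rewrite invg1 mul1g mulg1 zb -bb len1.
move=> /existsNP [k /not_implyP [desc nk]].
set s := transp n k (k + 1).
have e : ((w * s)^-1 * Theta b * (w * s) = s * z * s)%g.
  by rewrite invgM transpV /z !mulgA.
have up : (len (s * z * s)%g + 2 <= len z)%N by exact: len_fpf_conj_descent.
have [|v [ev lv]] := IH (w * s)%g; first by rewrite e; lia.
exists (v * s)%g; split.
  have -> : ((v * s)^-1 * Theta b * (v * s) = s * (v^-1 * Theta b * v) * s)%g.
    by rewrite invgM transpV !mulgA.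
  by rewrite ev e conj_transpK.
have := len_mul v s; have := len_simple k; rewrite -/s; move: lv; rewrite e; lia.
Qed.

Lemma len_conj_le T w : (len (w^-1 * T * w)%g <= 2 * len w + len T)%N.
Proof.
apply: leq_trans (len_mul _ _) _; apply: leq_trans (leq_add (len_mul _ _) (leqnn _)) _.
by rewrite lenV; lia.
Qed.

(** The bounds of [exists_short_conjugator] and [len_conj_le] meet, so minimality among conjugators
    turns into an equation between lengths. *)
Lemma fpf_atomsP z w : fpf_atoms z w <->
  exists b, (w^-1 * Theta b * w = z)%g /\ len z = (2 * len w + len (Theta b))%N.
Proof.
split=> [[T [hT wz min]]|[b [wz lz]]].
  have [b eT] : exists b, T = Theta b.
    by case: hT => ->; [exists true|exists false]; rewrite ?Theta_true ?Theta_false.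
  rewrite {}eT in wz min *; exists b; split => //.
  have [v [ev lv]] := exists_short_conjugator b w.
  have := len_conj_le (Theta b) w; rewrite wz; move: ev lv; rewrite wz => /min; lia.
exists (Theta b); split => //.
  by case: b {wz lz}; rewrite ?Theta_true ?Theta_false; [left|right].
by move=> v vz; have := len_conj_le (Theta b) v; rewrite vz; lia.
Qed.

(** * Reflections taking [z] down to an element [w] shorter by two *)

Section Cover.
Variables z w : affine_perm n.
Hypothesis zf : fpf z.
Hypothesis len_zw : len z = (len w + 2)%N.

Lemma cover_moved i j : (w = transp n i j * z * transp n i j)%g ->
  (transp n i j * z * transp n i j)%g <> z.
Proof. by move=> <- e; move: len_zw; rewrite e; lia. Qed.

Lemma cover_inversion i j : i < j -> ~ congr_mod i j ->
  (w = transp n i j * z * transp n i j)%g -> z j < z i.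
Proof.
move=> ij nij wE; case: (ltgtP (z i) (z j)) => [zij|//|/aperm_inj]; last lia.
by have := len_fpf_conj_up zf nij ij zij; rewrite -wE len_zw; lia.
Qed.

Lemma cover_atoms_mul p t : fpf_atoms w p -> (t * t = 1)%g ->
  len (p * t)%g = (len p + 1)%N -> z = (t * w * t)%g -> fpf_atoms z (p * t)%g.
Proof.
move=> /fpf_atomsP [b [ew lw]] tt lpt ez; apply/fpf_atomsP; exists b; split.
  by rewrite invgM (mulg1_eq tt) ez -ew !mulgA.
lia.
Qed.

(** [len_conj_le] for [p * t] bounds [len w], which is [len z - 2]; hence [len (p * t)] is at least
    [len p - 1], and the drop is exactly one. *)
Lemma cover_atoms_div p t : fpf_atoms z p -> (t * t = 1)%g ->
  (len (p * t)%g < len p)%N -> w = (t * z * t)%g ->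
  fpf_atoms w (p * t)%g /\ len p = (len (p * t)%g + 1)%N.
Proof.
move=> /fpf_atomsP [b [ez lz]] tt lpt ew.
have ept : ((p * t)^-1 * Theta b * (p * t) = w)%g.
  by rewrite invgM (mulg1_eq tt) ew -ez !mulgA.
have := len_conj_le (Theta b) (p * t)%g; rewrite ept => h.
by split; [apply/fpf_atomsP; exists b; split => //|]; lia.
Qed.

(** A reflection exchanging the two points of a 2-cycle of [z] commutes with [z], so conjugating by
    it would leave the length unchanged. *)
Lemma cover_not_swapped i j : ~ congr_mod i j ->
  w = (transp n i j * z * transp n i j)%g -> z i <> j.
Proof.
move=> nij wE zi; have := transp_conj_moved zf nij (cover_moved wE).
by rewrite -zi (zf i).1 zi transpL.
Qed.

(* If [p] inverted both twins, then [Theta] would invert the pair [p j < p i], so that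
   [z] would exchange [i] and [j]. *)
Lemma cover_twin_exclusive p i j : fpf_atoms z p -> ~ congr_mod i j ->
  w = (transp n i j * z * transp n i j)%g -> p j < p i -> p (z j) < p (z i).
Proof.
move=> /fpf_atomsP [b [ez _]] nij wE pji.
have Tp x : Theta b (p x) = p (z x) by rewrite -ez !apermME apermKV.
case: (ltgtP (p (z j)) (p (z i))) => [//|lt|/aperm_inj/aperm_inj ji].
  rewrite -!Tp in lt; have [_] := Theta_inversion pji lt.
  rewrite Tp => /aperm_inj zj; case: (cover_not_swapped nij wE).
  by rewrite -zj (zf j).1.
by move: pji; rewrite ji; lia.
Qed.

(** If [p] does not invert [i < j], then by [cover_twin_exclusive] with the indices exchanged it
    inverts the twin pair [z j < z i], and the twin conjugates [z] to the same [w]. *)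
Lemma cover_exists_descent p i j : fpf_atoms z p -> i < j -> ~ congr_mod i j ->
  w = (transp n i j * z * transp n i j)%g ->
  exists2 t, reflections t & w = (t * z * t)%g /\ (len (p * t)%g < len p)%N.
Proof.
move=> pz ij nij wE; have zji := cover_inversion ij nij wE.
have [pji|pij|/aperm_inj] := ltgtP (p j) (p i); last lia.
  exists (transp n i j); first exact: reflections_transp.
  by split => //; apply: len_transp_lt.
have nzij : ~ congr_mod (z j) (z i).
  by move=> [a /aperm_shift e]; apply: nij; exists (- a); lia.
have nji : ~ congr_mod j i by move=> [a e]; apply: nij; exists (- a); lia.
have pzij : p (z i) < p (z j).
  by apply: (cover_twin_exclusive pz nji) => //; rewrite transpC.
(* The twin argument needs the reflection to fix [z i] and [z j], which fails only if [z i] is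
   congruent to [j]. A negative [a] would make [w] longer than [z], a positive one contradicts
   [pzij], and zero means that [z] exchanges [i] and [j]. *)
have degenerate a : z i = j + a * n%:Z -> False.
  move=> zi; have zj := fpf_shift zf zi.
  have [a0|a0|a0] := ltrgtP a 0.
  - have := len_fpf_conj_long zf nij ij zi a0 zji; rewrite -wE len_zw; lia.
  - move: pzij; rewrite zi zj apermDM -mulNr apermDM; nia.
  - by apply: (cover_not_swapped nij wE); rewrite zi a0; lia.
exists (transp n (z j) (z i)); first exact: reflections_transp.
split; last exact: len_transp_lt.
rewrite transpC twin_reflection_conj //; apply: contrapT => /transp_moved [a [[e _]|[e _]]].
- by apply: (fpf_not_congr (i := i) zf); exists a.
- exact: degenerate e.
- by apply: (degenerate (- a)); have := fpf_shift zf e; lia.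
- by apply: (fpf_not_congr (i := j) zf); exists a.
Qed.

(** By [transp_conj_eq] the only other candidate is the twin of [t]; two covers would make [p]
    invert both pairs, against [cover_twin_exclusive]. *)
Lemma cover_descent_unique p t t' : fpf_atoms z p -> reflections t -> reflections t' ->
  w = (t * z * t)%g -> w = (t' * z * t')%g ->
  bruhat_cover (p * t)%g p -> bruhat_cover (p * t')%g p -> t = t'.
Proof.
move=> pz /reflectionsP [i [j [ij nij ->]]] /reflectionsP [k [l [kl nkl ->]]] wt wt' c c'.
have [//|e] := transp_conj_eq zf nij (cover_moved wt) (etrans (esym wt) wt').
have inv x y : x < y -> ~ congr_mod x y -> bruhat_cover (p * transp n x y)%g p -> p y < p x.
  move=> xy nxy [_ _ [_ lp]]; case: (ltgtP (p x) (p y)) => [pxy|//|/aperm_inj]; last lia.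
  by have := len_transp_gt nxy xy pxy; lia.
have nzij : ~ congr_mod (z j) (z i).
  by move=> [a /aperm_shift e']; apply: nij; exists (- a); lia.
have zji := cover_inversion ij nij wt.
have := cover_twin_exclusive pz nij wt (inv _ _ ij nij c).
by rewrite e transpC in c'; have := inv _ _ zji nzij c'; lia.
Qed.

End Cover.
End AffinePermFacts.

Theorem theorem5p6 (n : nat) (n_ge2 : (2 <= n)%N) (n_even : ~~ odd n)
    (y z : affine_perm n)
    (y_fpf : fpf_involutions y) (z_fpf : fpf_involutions z)
    (yz : fpf_cover y z) :
  set_bij
    [set pt : affine_perm n * affine_perm n |
       [/\ fpf_atoms y pt.1, reflections pt.2,
           bruhat_cover pt.1 (pt.1 * pt.2)%g
         & z = (pt.2 * y * pt.2)%g]]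
    (fpf_atoms z)
    (fun pt : affine_perm n * affine_perm n => (pt.1 * pt.2)%g).
Proof.
have reflK (t : affine_perm n) : reflections t -> (t * t = 1)%g.
  by move=> [i [j [_ _ ->]]]; apply: transpK.
have flip (t : affine_perm n) : reflections t -> z = (t * y * t)%g -> y = (t * z * t)%g.
  by move=> [i [j [_ _ ->]]] h; apply: conj_transp_eq.
have [t0 t0r [zE /fpf_length_cover lzy]] := yz.
have into (p t : affine_perm n) : fpf_atoms y p -> reflections t ->
    bruhat_cover p (p * t)%g -> z = (t * y * t)%g -> fpf_atoms z (p * t)%g.
  move=> py tr [_ _ [_ lpt]] ze.
  exact: (cover_atoms_mul n_ge2 n_even lzy py (reflK _ tr) lpt ze).
split.
- by move=> [p t] /= [py tr c ze]; apply: into.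
- move=> [p t] [p' t']; rewrite !inE /= => -[py tr c ze] [py' tr' c' ze'] e.
  (* Both pairs have the same product, an atom of [z]. Read from that product downwards, the two
     covers are descents to [y], so uniqueness identifies the reflections. *)
  have cE (q s : affine_perm n) : reflections s -> bruhat_cover q (q * s)%g ->
      bruhat_cover (q * s * s)%g (q * s)%g.
    by move=> /reflK sK; rewrite -mulgA sK mulg1.
  have tt : t = t'.
    apply: (cover_descent_unique n_ge2 n_even z_fpf lzy (into _ _ py tr c ze) tr tr'
      (flip _ tr ze) (flip _ tr' ze') (cE _ _ tr c)).
    by rewrite e; apply: cE.
  by move: e; rewrite tt => /mulIg ->.
(* The reflection [t0] of the given cover need not shorten the atom [s]; the [t] found below, which
   is [t0] or its twin, does. *)
- move=> s sz; have [i [j [ij nij t0E]]] := (reflectionsP n_ge2 t0).1 t0r.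
  have yE := flip _ t0r zE; rewrite t0E in yE.
  have [t tr [yt lst]] := cover_exists_descent n_ge2 n_even z_fpf lzy sz ij nij yE.
  have tK := reflK _ tr.
  have [sty ls] := cover_atoms_div n_ge2 n_even lzy sz tK lst yt.
  have stt : (s * t * t = s)%g by rewrite -mulgA tK mulg1.
  exists (s * t, t)%g => //=; split=> //=.
    by exists t => //; rewrite stt.
  by rewrite yt !mulgA tK mul1g -mulgA tK mulg1.
Qed.
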